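(* For every $\epsilon>0$ there exists $v_0(\epsilon)$ such that for every integer $v>v_0$ with $v\equiv 1\pmod 3$ there exists a $2-(v,4,1)$ directed design $\mathcal{D}$ with $f(\mathcal{D})\geq \frac{5}{8}-\frac{c}{v}$, where $c=\frac{13}{8}+\epsilon$.
   Context: A $2-(v,4,1)$ directed design is a pair $(V,\mathcal{B})$ with $|V|=v$ and $\mathcal{B}$ a collection of ordered 4-tuples of distinct elements of $V$ (blocks) such that every ordered pair $(x,y)$ of distinct elements of $V$ appears in exactly one block (i.e. $x$ and $y$ both occur in it with $x$ before $y$). A defining set of $\mathcal{D}=(V,\mathcal{B})$ is a subset $S\subseteq\mathcal{B}$ contained in no other $2-(v,4,1)$ directed design on $V$. $f(\mathcal{D})$ denotes the minimum cardinality of a defining set of $\mathcal{D}$ divided by $|\mathcal{B}|$. *)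

(* Defs.v *)
From HB Require Import structures.
From mathcomp Require Import all_boot all_order all_algebra reals.
Set Implicit Arguments.
Unset Strict Implicit.
Unset Printing Implicit Defensive.
Import Order.TTheory GRing.Theory Num.Theory.

Section DirectedDesign.

Variable V : finType.

Implicit Types (b : 4.-tuple V) (B S : {set 4.-tuple V}).

Definition precedes b (x y : V) : bool :=
  [exists i : 'I_4, exists j : 'I_4,
    [&& i < j, tnth b i == x & tnth b j == y]].

(* A set of blocks suffices: a repeated block would cover its pairs twice. *)
Definition directed_design B : bool :=
  [forall b in B, uniq b] &&
  [forall x : V, forall y : V,
    (x != y) ==> (#|[set b in B | precedes b x y]| == 1)].

Definition defining_set B S : bool :=
  (S \subset B) &&
  [forall B' : {set 4.-tuple V},
    (directed_design B' && (S \subset B')) ==> (B' == B)].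

(* A design is a defining set of itself, so the minimum in
   [min_defining_size] ranges over a nonempty family. *)
Lemma defining_set_refl B : directed_design B -> defining_set B B.
Proof.
case/andP=> _ /forallP dB; rewrite /defining_set subxx /=.
apply/forallP => B'; apply/implyP => /andP[/andP[/forallP uB' /forallP dB'] sBB'].
rewrite eq_sym eqEsubset sBB' /=; apply/subsetP => b bB'.
have ub : uniq b by apply: (implyP (uB' b)).
pose x := tnth b (inord 0); pose y := tnth b (inord 1).
have xy : x != y.
  by rewrite /x /y !(tnth_nth x) nth_uniq ?size_tuple ?inordK.
have bxy : precedes b x y.
  apply/existsP; exists (inord 0); apply/existsP; exists (inord 1).
  by rewrite !eqxx !inordK.
have /cards1P[c Ec] := implyP (forallP (dB x) y) xy.
have /cards1P[d Ed] := implyP (forallP (dB' x) y) xy.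
have := set11 c; rewrite -Ec inE => /andP[cB cxy].
have : c \in [set d] by rewrite -Ed inE (subsetP sBB').
have : b \in [set d] by rewrite -Ed inE bB'.
by rewrite !inE => /eqP-> /eqP<-.
Qed.

Definition min_defining_size B : nat :=
  #|[arg min_(S < B | defining_set B S) #|S|]|.

Definition defining_ratio (R : numFieldType) B : R :=
  ((min_defining_size B)%:R / #|B|%:R)%R.

End DirectedDesign.

(* Main.v *)
Require Import Defs.
From mathcomp Require Import all_boot all_order all_algebra all_field reals.
From mathcomp Require Import zify ring.
Import Order.TTheory GRing.Theory Num.Theory.

(** If two blocks [(.. x y ..)] and [(.. y x ..)] both contain x and y in
    adjacent positions, swapping x and y in both gives another directed design,
    so a defining set contains one of the two.  Hence if the blocks are
    partitioned into k cliques of pairwise related blocks, a defining set has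
    at least |B| - k blocks.  Directed group divisible designs of types 3^4
    and 3^5 exist whose 18, resp. 30, blocks fall into 6, resp. 10, such
    triangles.  Giving weight 3 to the points of a TD(5, m) with one group
    truncated to t points, and filling the groups together with one extra
    point, produces a design on 3(4m + t) + 1 points from designs on 3m + 1
    and 3t + 1 points.  By induction every v = 3n + 1 has a design with
    k <= |B|/3 + O(v), so that the ratio tends to at least 2/3 > 5/8. *)

Set Implicit Arguments.
Unset Strict Implicit.
Unset Printing Implicit Defensive.

Section Pairs.

Variable V : eqType.
Implicit Types (s A B : seq V) (bs : seq (seq V)).

Fixpoint pairs s : seq (V * V) :=
  if s is x :: s' then [seq (x, y) | y <- s'] ++ pairs s' else [::].

Definition covered bs : seq (V * V) := flatten (map pairs bs).

Definition steps s : seq (V * V) := zip s (behead s).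

Definition linked A B : bool :=
  has (fun p => (p.2, p.1) \in steps B) (steps A).

Lemma covered_cat bs1 bs2 : covered (bs1 ++ bs2) = covered bs1 ++ covered bs2.
Proof. by rewrite /covered map_cat flatten_cat. Qed.

Lemma covered_cons b bs : covered (b :: bs) = pairs b ++ covered bs.
Proof. by []. Qed.

Lemma perm_covered bs bs' :
  perm_eq bs bs' -> perm_eq (covered bs) (covered bs').
Proof. by move=> P; apply/perm_flatten/perm_map. Qed.

Lemma mem_pairs s x y : (x, y) \in pairs s ->
  exists i j, [/\ i < j, j < size s, nth x s i = x & nth x s j = y].
Proof.
elim: s => //= z s IHs; rewrite mem_cat => /orP[/mapP[w ws [-> ->]]|/IHs].
  by exists 0, (index w s).+1; split; rewrite /= ?nth_index // ltnS index_mem.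
by case=> i [j] [ij js xi yj]; exists i.+1, j.+1.
Qed.

Lemma pairs_mem s x0 i j : i < j -> j < size s ->
  (nth x0 s i, nth x0 s j) \in pairs s.
Proof.
elim: s i j => // z s IHs [|i] [|j] //= ij js; rewrite mem_cat.
  by rewrite map_f ?mem_nth.
by rewrite IHs ?orbT.
Qed.

Lemma uniq_of_pairs s : (forall x, (x, x) \notin pairs s) -> uniq s.
Proof.
elim: s => //= x s IHs H; apply/andP; split.
  by apply/negP => xs; have := H x; rewrite mem_cat map_f.
by apply: IHs => y; have := H y; rewrite mem_cat negb_or => /andP[].
Qed.

Lemma size_pairs4 s : size s = 4 -> size (pairs s) = 6.
Proof. by case: s => [|a [|b [|c [|d []]]]]. Qed.

Lemma size_covered bs : {in bs, forall b, size b = 4} ->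
  size (covered bs) = 6 * size bs.
Proof.
elim: bs => //= b bs IHb H; rewrite size_cat size_pairs4 ?H ?mem_head //.
by rewrite IHb ?mulnS // => c cb; rewrite H // inE cb orbT.
Qed.

Lemma covered_inj bs b b' p : uniq (covered bs) -> b \in bs -> b' \in bs ->
  p \in pairs b -> p \in pairs b' -> b = b'.
Proof.
elim: bs => //= c bs IHb; rewrite /covered /= cat_uniq => /and3P[_ H U].
have nH d : d \in bs -> p \in pairs d -> p \notin pairs c.
  move=> db pd; apply: contra H => pc; apply/hasP; exists p => //.
  by apply/flattenP; exists (pairs d); rewrite ?map_f.
rewrite !inE => /predU1P[->|bb] /predU1P[->|bb'] // pb pb'.
- by have := nH _ bb' pb'; rewrite pb.
- by have := nH _ bb pb; rewrite pb'.
- exact: IHb.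
Qed.

Lemma uniq_of_covered bs : {in bs, forall b, size b = 4} ->
  uniq (covered bs) -> uniq bs.
Proof.
elim: bs => //= b bs IHb sz; rewrite /covered /= cat_uniq => /and3P[_ H U].
rewrite IHb // => [|c cb]; last by rewrite sz // inE cb orbT.
rewrite andbT; apply: contra H => bb; apply/hasP.
case E: (pairs b) => [|p q]; first by have := size_pairs4 (sz b (mem_head _ _)); rewrite E.
exists p; last by rewrite /= mem_head.
by apply/flattenP; exists (pairs b); rewrite ?map_f // E mem_head.
Qed.

Lemma steps_split s x y : (x, y) \in steps s ->
  exists l1 l2, s = l1 ++ x :: y :: l2.
Proof.
rewrite /steps; elim: s => // z [//|w s] IHs; rewrite [zip _ _]/= inE.
case/predU1P => [[-> ->]|/IHs[l1 [l2 E]]]; first by exists [::], s.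
by exists (z :: l1), l2; rewrite E.
Qed.

Lemma steps_mid l1 x y l2 : (x, y) \in steps (l1 ++ x :: y :: l2).
Proof.
rewrite /steps; elim: l1 => [|z [|w l1] IHl] /=; first by rewrite inE eqxx.
  by rewrite !inE eqxx orbT.
by rewrite inE IHl orbT.
Qed.

Lemma steps_pairs s p : p \in steps s -> p \in pairs s.
Proof.
rewrite /steps; elim: s => // z [//|w s] IHs; rewrite [zip _ _]/= inE.
rewrite -[pairs _]/(map (pair z) (w :: s) ++ pairs (w :: s)) mem_cat.
by case/predU1P => [->|/IHs->]; rewrite ?orbT //= inE eqxx.
Qed.

Lemma count_pairs_swap a l1 x y l2 :
  count a (pairs (l1 ++ x :: y :: l2)) + a (y, x) =
  count a (pairs (l1 ++ y :: x :: l2)) + a (x, y).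
Proof.
elim: l1 => [|z l1 IHl]; rewrite /= !count_cat /= ?count_cat.
  by rewrite !addnA; lia.
rewrite !map_cat !count_cat /=; lia.
Qed.

Lemma count_pairs_swap2 a l1 l2 l3 l4 x y :
  count a (pairs (l1 ++ x :: y :: l2)) + count a (pairs (l3 ++ y :: x :: l4)) =
  count a (pairs (l1 ++ y :: x :: l2)) + count a (pairs (l3 ++ x :: y :: l4)).
Proof.
have := count_pairs_swap a l1 x y l2; have := count_pairs_swap a l3 y x l4.
by lia.
Qed.

End Pairs.

Section Map.

Variables (V W : eqType) (f : V -> W).

Definition pmap2 (p : V * V) : W * W := (f p.1, f p.2).

Lemma pairs_map s : pairs (map f s) = map pmap2 (pairs s).
Proof. by elim: s => //= x s ->; rewrite map_cat -!map_comp. Qed.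

Lemma covered_map bs : covered (map (map f) bs) = map pmap2 (covered bs).
Proof.
rewrite /covered map_flatten -!map_comp; congr flatten.
by apply: eq_map => s /=; rewrite pairs_map.
Qed.

Lemma steps_map s : steps (map f s) = map pmap2 (steps s).
Proof.
by rewrite /steps behead_map; elim: s (behead s) => [|x s IHs] [|y t] //=; rewrite IHs.
Qed.

Lemma linked_map A B : linked A B -> linked (map f A) (map f B).
Proof.
case/hasP => -[x y] xA yB; apply/hasP; exists (f x, f y).
  by rewrite steps_map (map_f pmap2 xA).
by rewrite steps_map (map_f pmap2 yB).
Qed.

End Map.

Section Trade.

Variable V : finType.
Implicit Types (s : seq (4.-tuple V)) (S : {set 4.-tuple V}).

Definition blocks s : seq (seq V) := map val s.

Definition design_list s :=
  uniq (covered (blocks s)) /\ forall x y, ((x, y) \in covered (blocks s)) = (x != y).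

Lemma precedesE (b : 4.-tuple V) x y : precedes b x y = ((x, y) \in pairs b).
Proof.
apply/existsP/idP => [[i /existsP[j /and3P[ij /eqP<- /eqP<-]]]|].
  by rewrite !(tnth_nth x) pairs_mem ?size_tuple.
case/mem_pairs => i [j] [ij]; rewrite size_tuple => j4 xi yj.
exists (Ordinal (ltn_trans ij j4)); apply/existsP; exists (Ordinal j4).
by rewrite !(tnth_nth x) /= xi yj ij !eqxx.
Qed.

Lemma size_blocks s : {in blocks s, forall b, size b = 4}.
Proof. by move=> b /mapP[c _ ->]; rewrite size_tuple. Qed.

Lemma design_listP s : design_list s -> directed_design [set b in s].
Proof.
case=> U H; apply/andP; split.
  apply/'forall_implyP => b; rewrite inE => bs; apply: uniq_of_pairs => x.
  apply/negP => xb; have := H x x; rewrite eqxx => /negP[].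
  by apply/flattenP; exists (pairs b); rewrite // map_f ?map_f.
apply/'forall_forallP => x y; apply/implyP => xy.
have /flattenP[q /mapP[c /mapP[b bs ->] ->] xyb] : (x, y) \in covered (blocks s).
  by rewrite H.
apply/cards1P; exists b; apply/setP => d; rewrite !inE precedesE.
apply/andP/eqP => [[ds xyd]|->//]; apply/val_inj.
by apply: covered_inj U _ _ xyd xyb; rewrite map_f.
Qed.

Lemma design_list_uniq s : design_list s -> uniq s.
Proof.
case=> U _; apply: (map_uniq (f := val)); apply: uniq_of_covered U.
exact: size_blocks.
Qed.

Lemma linked_not_defining s A B S : design_list s ->
  defining_set [set b in s] S -> A \in s -> B \in s -> A != B ->
  linked A B -> A \notin S -> B \in S.
Proof.
move=> Ds /andP[/subsetP sS /forallP dS] As Bs AB lAB AS; apply: contraT => BS.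
case/hasP: lAB => -[x y] /steps_split[l1 [l2 EA]] /steps_split[l3 [l4 EB]].
have [U H] := Ds.
have szA : size (l1 ++ y :: x :: l2) == 4.
  by rewrite -(size_tuple A) EA !size_cat.
have szB : size (l3 ++ x :: y :: l4) == 4.
  by rewrite -(size_tuple B) EB !size_cat.
pose A' := Tuple szA; pose B' := Tuple szB.
pose r := rem B (rem A s).
have Us := design_list_uniq Ds.
have BrA : B \in rem A s by rewrite mem_rem_uniq // inE eq_sym AB.
have Ps : perm_eq s (A :: B :: r).
  by apply: (perm_trans (perm_to_rem As)); rewrite perm_cons perm_to_rem.
have Pc : perm_eq (covered (blocks s)) (covered (blocks (A' :: B' :: r))).
  apply: (perm_trans (perm_covered (perm_map val Ps))).
  apply/permP => a; rewrite /blocks !map_cons !covered_cons !count_cat.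
  rewrite -[val A]/(tval A) -[val B]/(tval B) EA EB.
  rewrite [val A']/= [val B']/= /blocks.
  by rewrite !addnA count_pairs_swap2.
have Ds' : design_list (A' :: B' :: r).
  by split=> [|u w]; rewrite -?(perm_uniq Pc) // -(perm_mem Pc).
have sub : S \subset [set b in A' :: B' :: r].
  apply/subsetP => b bS; have := sS b bS; rewrite !inE (perm_mem Ps) !inE.
  case/or3P=> [/eqP bA|/eqP bB|->]; last by rewrite !orbT.
    by rewrite bA (negPf AS) in bS.
  by rewrite bB (negPf BS) in bS.
have := dS [set b in A' :: B' :: r]; rewrite design_listP // sub /= => /eqP E.
have A's : A' \in s by have /setP/(_ A') := E; rewrite !inE eqxx.
have AA' : val A = val A'.
  (* blocks have size 4, so A and A' still share an ordered pair *)
  have [p] : exists2 p, p \in pairs (l1 ++ x :: y :: l2) &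
      p \in pairs (l1 ++ y :: x :: l2).
    case: (l1) (l2) (szA) => [|z l1'] [|t l2'] //= _.
    - by exists (x, t); rewrite !(inE, mem_cat) eqxx ?orbT.
    - by exists (z, x); rewrite !map_cat !(inE, mem_cat) eqxx ?orbT.
    - by exists (z, x); rewrite !map_cat !(inE, mem_cat) eqxx ?orbT.
  by rewrite -EA; exact: covered_inj U (map_f val As) (map_f val A's).
have /eqP[] : x != y.
  rewrite -H; apply/flattenP; exists (pairs A); first by rewrite !map_f.
  by apply: steps_pairs; rewrite EA steps_mid.
by move: AA'; rewrite [val A]EA /= => /(congr1 (drop (size l1))); rewrite !drop_size_cat // => -[].
Qed.

Lemma count_le1 (T : eqType) (r : rel T) (P : pred T) (c : seq T) :
  uniq c -> pairwise r c ->
  (forall x y, x \in c -> y \in c -> x != y -> r x y -> P x -> ~~ P y) ->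
  count P c <= 1.
Proof.
rewrite -size_filter => uc rc H; have := filter_uniq P uc.
have : pairwise r (filter P c) by rewrite pairwise_filter.
have : {subset filter P c <= [pred x | (x \in c) && P x]}.
  by move=> x; rewrite mem_filter inE andbC.
case: (filter P c) => [|x [|y t]] // sub /= /andP[/andP[rxy _] _] /andP[].
rewrite inE negb_or => /andP[xy _] _.
have /sub/andP[xc Px] : x \in [:: x, y & t] by rewrite mem_head.
have /sub/andP[yc Py] : y \in [:: x, y & t] by rewrite !inE eqxx orbT.
by have := H _ _ xc yc xy rxy Px; rewrite Py.
Qed.

Lemma defining_set_ge (L : seq (seq (4.-tuple V))) S :
  design_list (flatten L) ->
  all (pairwise (fun A B : 4.-tuple V => linked A B)) L ->
  defining_set [set b in flatten L] S -> size (flatten L) <= #|S| + size L.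
Proof.
move=> Ds pL dS; have Us := design_list_uniq Ds.
rewrite -(count_predC (mem S)) leq_add //.
  rewrite -size_filter cardE; apply: uniq_leq_size => [|b]; first exact: filter_uniq.
  by rewrite mem_filter mem_enum => /andP[].
have Uc c : c \in L -> uniq c.
  move=> cL; apply: subseq_uniq Us.
  case/splitPr: cL => l1 l2; rewrite flatten_cat.
  exact: subseq_trans (prefix_subseq c _) (suffix_subseq _ _).
have sL c : c \in L -> {subset c <= flatten L}.
  by move=> cL b bc; apply/flattenP; exists c.
have le1 c : c \in L -> count (predC (mem S)) c <= 1.
  move=> cL; apply: count_le1 (Uc c cL) (allP pL c cL) _ => A B Ac Bc AB lAB AS.
  rewrite negbK; exact: linked_not_defining Ds dS (sL c cL A Ac) (sL c cL B Bc) AB lAB AS.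
rewrite count_flatten; elim: L le1 {Ds dS Us pL Uc sL} => //= c L IHL le1.
apply: (@leq_add _ _ 1 (size L)); first by rewrite le1 ?mem_head.
by apply: IHL => d dL; rewrite le1 // inE dL orbT.
Qed.

End Trade.

Definition packing (V : eqType) (Q : rel V) (k : nat) : Prop :=
  exists L : seq (seq (seq V)),
    [/\ size L <= k, {in flatten L, forall b, size b = 4},
        all (pairwise (@linked V)) L, uniq (covered (flatten L)) &
        forall x y, ((x, y) \in covered (flatten L)) = Q x y].

Definition complete (V : eqType) (w : seq V) : rel V :=
  fun x y => [&& x \in w, y \in w & x != y].

Section Packing.

Variable V : eqType.
Implicit Types Q : rel V.

Lemma eq_packing Q Q' k : Q =2 Q' -> packing Q k -> packing Q' k.
Proof.
by move=> eqQ [L [sL L4 pL uL QL]]; exists L; split=> // x y; rewrite QL eqQ.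
Qed.

Lemma packing0 Q : (forall x y, Q x y = false) -> packing Q 0.
Proof. by move=> Q0; exists [::]; split=> // x y; rewrite Q0. Qed.

Lemma packingU Q1 Q2 k1 k2 :
  (forall x y, Q1 x y -> ~~ Q2 x y) -> packing Q1 k1 -> packing Q2 k2 ->
  packing (fun x y => Q1 x y || Q2 x y) (k1 + k2).
Proof.
move=> Q12 [L1 [sL1 L14 pL1 uL1 QL1]] [L2 [sL2 L24 pL2 uL2 QL2]].
exists (L1 ++ L2); split; rewrite ?size_cat ?leq_add ?flatten_cat ?all_cat ?pL1 //.
- by move=> b; rewrite mem_cat => /orP[/L14|/L24].
- rewrite covered_cat cat_uniq uL1 uL2 andbT; apply/hasPn => -[x y].
  by rewrite QL2 => Q2xy /=; rewrite QL1; apply: contraL Q2xy => /Q12.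
- by move=> x y; rewrite covered_cat mem_cat QL1 QL2.
Qed.

Lemma packing_bigU (I : eqType) (s : seq I) (Q_ : I -> rel V) (k_ : I -> nat) Q :
  {in s, forall i, packing (Q_ i) (k_ i)} ->
  (forall x y, count (fun i => Q_ i x y) s = Q x y) ->
  packing Q (\sum_(i <- s) k_ i).
Proof.
elim: s Q => [|i s IHs] Q Ps Qs; rewrite ?big_nil ?big_cons.
  by apply: packing0 => x y; have := Qs x y => /=; case: (Q x y).
pose Q' x y := has (fun i => Q_ i x y) s.
apply: (@eq_packing (fun x y => Q_ i x y || Q' x y)).
  move=> x y; have := Qs x y; rewrite /Q' has_count /=.
  by case: (Q_ i x y) (Q x y) (count _ s) => [] [] // [|[]].
apply: packingU; first 1 last.
- by apply: Ps; rewrite mem_head.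
- apply: IHs => [j js|x y]; first by apply: Ps; rewrite inE js orbT.
  have := Qs x y; rewrite /Q' has_count /=.
  by case: (Q_ i x y) (Q x y) (count _ s) => [] [] // [|[]].
- move=> x y; have := Qs x y; rewrite /Q' has_count /=.
  by case: (Q_ i x y) (Q x y) (count _ s) => [] [] // [|[]].
Qed.

End Packing.

Lemma packing_map (V W : eqType) (f : V -> W) (D : pred V) (Q : rel V)
    (Q' : rel W) k :
  {in D &, injective f} -> (forall x y, Q x y -> D x && D y) ->
  {in D &, forall x y, Q' (f x) (f y) = Q x y} ->
  (forall u w, Q' u w -> exists x y, [/\ D x, D y, u = f x & w = f y]) ->
  packing Q k -> packing Q' k.
Proof.
move=> injf QD QQ' Q'f [L [sL L4 pL uL QL]].
exists (map (map (map f)) L); rewrite -map_flatten covered_map; split.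
- by rewrite size_map.
- by move=> _ /mapP[b bL ->]; rewrite size_map L4.
- rewrite all_map; apply: sub_all pL => c; rewrite /= pairwise_map.
  by apply: sub_pairwise => A B /=; apply: linked_map.
- rewrite map_inj_in_uniq // => -[x y] [z t]; rewrite !QL.
  move=> /QD/andP[xD yD] /QD/andP[zD tD] [xz yt].
  by rewrite (injf x z xD zD xz) (injf y t yD tD yt).
- move=> u w; apply/mapP/idP => [[[x y]]|Q'uw].
    by rewrite QL => Qxy [-> ->]; have /andP[xD yD] := QD _ _ Qxy; rewrite QQ'.
  have [x [y [xD yD Eu Ew]]] := Q'f _ _ Q'uw.
  exists (x, y); last by rewrite Eu Ew.
  by rewrite QL -(QQ' x y xD yD) -Eu -Ew.
Qed.

Lemma packing_complete (V W : eqType) (w : seq V) (w' : seq W) (y0 : W) k :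
  uniq w -> uniq w' -> size w = size w' ->
  packing (complete w) k -> packing (complete w') k.
Proof.
move=> uw uw' sw.
have inj : {in mem w &, injective (fun x => nth y0 w' (index x w))}.
  move=> x y xw yw /eqP; rewrite nth_uniq -?sw ?index_mem // => /eqP E.
  by rewrite -(nth_index x xw) E nth_index.
apply: (@packing_map _ _ (fun x => nth y0 w' (index x w)) (mem w)) => //.
- by move=> x y /and3P[xw yw _]; apply/andP.
- move=> x y xw yw; rewrite /complete !mem_nth -?sw ?index_mem //.
  by rewrite [x \in w]xw [y \in w]yw (inj_in_eq inj).
- have w'P u : u \in w' -> exists2 x, x \in w & u = nth y0 w' (index x w).
    move=> uw0; have : index u w' < size w by rewrite sw index_mem.
    case: w uw sw {inj} => [//|x0 w1] uw sw lt.
    exists (nth x0 (x0 :: w1) (index u w')); first exact: mem_nth.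
    by rewrite index_uniq // nth_index.
  by move=> u v /and3P[/w'P[x xw ->] /w'P[y yw ->] _]; exists x, y.
Qed.

Definition lexi (p q : nat * nat) : bool :=
  (p.1 < q.1) || (p.1 == q.1) && (p.2 <= q.2).

Definition check (v : nat) (Q : rel nat) (L : seq (seq (seq nat))) : bool :=
  [&& all (fun b => size b == 4) (flatten L), all (pairwise (@linked nat)) L &
      sort lexi (covered (flatten L)) ==
      [seq p <- [seq (x, y) | x <- iota 0 v, y <- iota 0 v] | Q p.1 p.2]].

Lemma checkP v Q L : check v Q L ->
  packing (fun x y => [&& x < v, y < v & Q x y]) (size L).
Proof.
case/and3P=> /allP L4 pL /eqP E; exists L; split=> // [b /L4/eqP //||x y].
  rewrite -(sort_uniq lexi) E filter_uniq // allpairs_uniq ?iota_uniq //.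
  by move=> [a b] [c d].
rewrite -(mem_sort lexi) E mem_filter andbC /= [RHS]andbA; congr (_ && _).
apply/allpairsP/andP => [[[a b] [/= ]]|[xv yv]].
  by rewrite !mem_iota => /= av bv [-> ->].
by exists (x, y); rewrite !mem_iota.
Qed.

Definition design_on n k := packing (complete (iota 0 (3 * n).+1)) k.

Lemma check_design n L : check (3 * n).+1 (fun x y => x != y) L ->
  design_on n (size L).
Proof.
move/checkP; apply: eq_packing => x y.
by rewrite /complete !mem_iota.
Qed.

(* Found by computer search: point [3 g + i] is the [i]-th point of group [g]. *)
Definition cliques4 : seq (seq (seq nat)) :=
  [::
    [:: [:: 1; 11; 7; 5]; [:: 4; 2; 7; 11]; [:: 5; 7; 2; 10]];
    [:: [:: 3; 7; 9; 1]; [:: 9; 7; 0; 4]; [:: 10; 0; 7; 3]];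
    [:: [:: 0; 10; 6; 5]; [:: 4; 1; 6; 10]; [:: 5; 6; 1; 9]];
    [:: [:: 3; 8; 10; 2]; [:: 10; 8; 1; 4]; [:: 11; 1; 8; 3]];
    [:: [:: 2; 9; 8; 5]; [:: 4; 0; 8; 9]; [:: 5; 8; 0; 11]];
    [:: [:: 3; 6; 11; 0]; [:: 9; 2; 6; 3]; [:: 11; 6; 2; 4]]].

Definition cliques5 : seq (seq (seq nat)) :=
  [seq [seq [seq (z + 3 * k) %% 15 | z <- b] | b <- c] |
    c <- [::
      [:: [:: 0; 4; 7; 9]; [:: 11; 4; 0; 12]; [:: 7; 4; 11; 13]];
      [:: [:: 0; 3; 8; 13]; [:: 12; 11; 8; 3]; [:: 2; 13; 8; 11]]], k <- iota 0 5].

Fixpoint radix_add (ms : seq nat) (x y : nat) : nat :=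
  if ms is m :: ms' then
    (x %% m + y %% m) %% m + m * radix_add ms' (x %/ m) (y %/ m)
  else 0.

(* Apart from the last few points, which are fixed, the points are copies of
   the group [Z_m1 * Z_m2 * ...] coded in mixed radix.  Each block is a clique
   by itself. *)
Definition develop (v : nat) (ms : seq nat) (base : seq (seq nat)) :
    seq (seq (seq nat)) :=
  let N := foldr muln 1 ms in
  let shift k p :=
    if p < v %/ N * N then p %/ N * N + radix_add ms (p %% N) k else p in
  [seq [:: map (shift k) b] | b <- base, k <- iota 0 N].

Definition base_designs : seq (nat * (seq nat * seq (seq nat))) :=
  [::
  (1, ([:: 1], [::
    [:: 0; 1; 2; 3]; [:: 3; 2; 1; 0]]));
  (2, ([:: 7], [::
    [:: 0; 6; 3; 1]]));
  (3, ([:: 3], [::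
    [:: 3; 6; 2; 0]; [:: 0; 2; 8; 4]; [:: 3; 7; 8; 5]; [:: 3; 1; 9; 4];
    [:: 6; 9; 1; 8]]));
  (4, ([:: 13], [::
    [:: 0; 12; 10; 4]; [:: 0; 1; 3; 9]]));
  (5, ([:: 5], [::
    [:: 0; 9; 1; 4]; [:: 10; 1; 3; 9]; [:: 5; 14; 15; 1]; [:: 0; 15; 12; 5];
    [:: 10; 0; 11; 13]; [:: 0; 10; 7; 14]; [:: 10; 5; 6; 4]; [:: 5; 9; 7; 10]]));
  (6, ([:: 19], [::
    [:: 0; 18; 15; 3]; [:: 0; 12; 10; 2]; [:: 0; 8; 13; 14]]));
  (7, ([:: 7], [::
    [:: 14; 6; 1; 19]; [:: 14; 5; 2; 17]; [:: 14; 3; 4; 20]; [:: 7; 6; 2; 11];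
    [:: 7; 5; 4; 8]; [:: 7; 3; 1; 9]; [:: 14; 13; 9; 18]; [:: 14; 12; 11; 15];
    [:: 14; 10; 8; 16]; [:: 0; 7; 14; 21]; [:: 21; 14; 7; 0]]));
  (8, ([:: 5; 5], [::
    [:: 0; 24; 19; 23]; [:: 0; 18; 8; 16]; [:: 0; 12; 22; 14];
    [:: 0; 6; 11; 7]]));
  (9, ([:: 9], [::
    [:: 0; 8; 1; 19]; [:: 18; 6; 1; 4]; [:: 9; 7; 11; 3]; [:: 9; 23; 8; 5];
    [:: 0; 17; 14; 9]; [:: 0; 11; 10; 22]; [:: 9; 4; 25; 18];
    [:: 9; 6; 12; 22]; [:: 9; 0; 26; 27]; [:: 18; 23; 7; 22];
    [:: 18; 5; 12; 17]; [:: 27; 26; 14; 7]; [:: 18; 9; 24; 16];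
    [:: 18; 21; 19; 14]]));
  (10, ([:: 31], [::
    [:: 0; 30; 25; 3]; [:: 0; 29; 19; 6]; [:: 0; 27; 7; 12];
    [:: 0; 23; 14; 24]; [:: 0; 15; 28; 17]]));
  (11, ([:: 11], [::
    [:: 11; 10; 4; 18]; [:: 11; 8; 1; 21]; [:: 11; 2; 3; 19];
    [:: 11; 6; 9; 13]; [:: 11; 7; 5; 17]; [:: 22; 10; 9; 26];
    [:: 22; 8; 5; 23]; [:: 22; 2; 4; 25]; [:: 22; 6; 1; 31];
    [:: 22; 7; 3; 27]; [:: 22; 21; 15; 29]; [:: 22; 19; 12; 32];
    [:: 22; 13; 14; 30]; [:: 22; 17; 20; 24]; [:: 22; 18; 16; 28];
    [:: 0; 11; 22; 33]; [:: 33; 22; 11; 0]]));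
  (12, ([:: 37], [::
    [:: 0; 36; 34; 13]; [:: 0; 26; 4; 32]; [:: 0; 27; 7; 19];
    [:: 0; 1; 3; 24]; [:: 0; 11; 33; 5]; [:: 0; 10; 30; 18]]));
  (13, ([:: 13], [::
    [:: 13; 12; 11; 20]; [:: 13; 9; 5; 15]; [:: 13; 10; 7; 21];
    [:: 13; 1; 2; 19]; [:: 13; 4; 8; 24]; [:: 13; 3; 6; 18];
    [:: 26; 12; 7; 36]; [:: 26; 9; 2; 27]; [:: 26; 10; 8; 30];
    [:: 26; 1; 6; 29]; [:: 26; 4; 11; 38]; [:: 26; 3; 5; 35];
    [:: 26; 25; 24; 33]; [:: 26; 22; 18; 28]; [:: 26; 23; 20; 34];
    [:: 26; 14; 15; 32]; [:: 26; 17; 21; 37]; [:: 26; 16; 19; 31];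
    [:: 0; 13; 26; 39]; [:: 39; 26; 13; 0]]));
  (14, ([:: 43], [::
    [:: 0; 42; 40; 33]; [:: 0; 39; 31; 3]; [:: 0; 27; 38; 12];
    [:: 0; 22; 23; 5]; [:: 0; 2; 6; 20]; [:: 0; 8; 24; 37]; [:: 0; 32; 10; 19]]));
  (15, ([:: 15], [::
    [:: 15; 13; 14; 41]; [:: 15; 7; 11; 44]; [:: 30; 14; 7; 21];
    [:: 30; 11; 13; 24]; [:: 0; 39; 6; 32]; [:: 0; 36; 9; 38];
    [:: 0; 23; 14; 12]; [:: 0; 17; 11; 3]; [:: 0; 27; 24; 16];
    [:: 0; 18; 21; 19]; [:: 15; 34; 12; 43]; [:: 15; 31; 3; 37];
    [:: 30; 29; 37; 1]; [:: 30; 26; 43; 4]; [:: 15; 24; 36; 23];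
    [:: 15; 21; 39; 17]; [:: 30; 34; 33; 22]; [:: 30; 31; 42; 28];
    [:: 15; 30; 10; 0]; [:: 0; 10; 40; 20]; [:: 15; 35; 40; 25];
    [:: 15; 5; 45; 20]; [:: 30; 45; 5; 40]]));
  (26, ([:: 79], [::
    [:: 0; 78; 76; 5]; [:: 0; 71; 55; 40]; [:: 0; 15; 45; 4];
    [:: 0; 41; 44; 32]; [:: 0; 12; 36; 19]; [:: 0; 17; 51; 73];
    [:: 0; 57; 13; 31]; [:: 0; 61; 25; 11]; [:: 0; 14; 42; 9];
    [:: 0; 33; 20; 72]; [:: 0; 27; 2; 23]; [:: 0; 58; 16; 26];
    [:: 0; 69; 49; 50]]));
  (27, ([:: 3; 3; 3], [::
    [:: 27; 26; 8; 44]; [:: 27; 10; 25; 31]; [:: 27; 24; 1; 41];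
    [:: 27; 19; 9; 29]; [:: 27; 3; 15; 45]; [:: 27; 5; 13; 48];
    [:: 27; 23; 20; 53]; [:: 27; 17; 12; 37]; [:: 27; 4; 11; 51];
    [:: 27; 14; 6; 46]; [:: 27; 2; 7; 30]; [:: 27; 18; 16; 32];
    [:: 27; 21; 22; 50]; [:: 54; 26; 20; 79]; [:: 54; 10; 12; 55];
    [:: 54; 24; 11; 63]; [:: 54; 19; 6; 69]; [:: 54; 3; 7; 67];
    [:: 54; 5; 16; 74]; [:: 54; 23; 22; 66]; [:: 54; 17; 8; 65];
    [:: 54; 4; 25; 60]; [:: 54; 14; 1; 61]; [:: 54; 2; 9; 70];
    [:: 54; 18; 15; 76]; [:: 54; 21; 13; 62]; [:: 54; 53; 35; 71];
    [:: 54; 37; 52; 58]; [:: 54; 51; 28; 68]; [:: 54; 46; 36; 56];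
    [:: 54; 30; 42; 72]; [:: 54; 32; 40; 75]; [:: 54; 50; 47; 80];
    [:: 54; 44; 39; 64]; [:: 54; 31; 38; 78]; [:: 54; 41; 33; 73];
    [:: 54; 29; 34; 57]; [:: 54; 45; 43; 59]; [:: 54; 48; 49; 77];
    [:: 0; 27; 54; 81]; [:: 81; 54; 27; 0]]))].

(* The base designs have at most 82 points, and 164 = 2 * 82 makes the bound
   trivial for them; the recursion preserves it. *)
Definition good n := exists2 k, design_on n k & 6 * k <= n * (3 * n).+1 + 164 * n.

Lemma packing_cliques4 :
  packing (fun x y => [&& x < 3 * 4, y < 3 * 4 & x %/ 3 != y %/ 3]) 6.
Proof. by apply: (checkP (L := cliques4)); vm_compute. Qed.

Lemma packing_cliques5 :
  packing (fun x y => [&& x < 3 * 5, y < 3 * 5 & x %/ 3 != y %/ 3]) 10.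
Proof. by apply: (checkP (L := cliques5)); vm_compute. Qed.

Lemma base_designs_check :
  all (fun t => let L := develop (3 * t.1).+1 t.2.1 t.2.2 in
    check (3 * t.1).+1 (fun x y => x != y) L &&
    (6 * size L <= t.1 * (3 * t.1).+1 + 164 * t.1)) base_designs.
Proof. by vm_compute. Qed.

Lemma good_base n : n \in map fst base_designs -> good n.
Proof.
case/mapP => t tB ->; have /andP[c s] := allP base_designs_check t tB.
exact: ex_intro2 (check_design c) s.
Qed.

Lemma good0 : good 0.
Proof.
exists 0 => //; apply: packing0 => x y; rewrite /complete !inE.
by case: eqP => //= ->; case: eqP => // ->.
Qed.

Section TransversalDesign.

Variables (R : finComUnitRingType) (a b : R).

Local Open Scope ring_scope.

(* Column [g] of the transversal design meets the line [(u, v)] in [u], [v],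
   [u + v], [u + a v], [u + b v] for [g] = 0, 1, 2, 3, 4. *)
Definition col_u (g : nat) : R := (g != 1)%:R.
Definition col_v (g : nat) : R :=
  match g with 0 => 0 | 1 | 2 => 1 | 3 => a | _ => b end.
Definition form (g : nat) (l : R * R) : R := col_u g * l.1 + col_v g * l.2.

Hypotheses (Ua : a \is a GRing.unit) (Ub : b \is a GRing.unit).
Hypotheses (Ua1 : a - 1 \is a GRing.unit) (Ub1 : b - 1 \is a GRing.unit).
Hypothesis Uba : b - a \is a GRing.unit.

Lemma det_unit g h : (g < h)%N -> (h < 5)%N ->
  col_u g * col_v h - col_v g * col_u h \is a GRing.unit.
Proof.
case: h => [|[|[|[|[|//]]]]] //; case: g => [|[|[|[|//]]]] // _ _;
  by rewrite /col_u /col_v /= ?(mul0r, mul1r, mulr1, mulr0, subr0, sub0r, unitrN, unitr1).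
Qed.

Lemma two_columns g h r s : (g < 5)%N -> (h < 5)%N -> g != h ->
  exists l, forall m, (form g m == r) && (form h m == s) = (m == l).
Proof.
wlog gh : g h r s / (g < h)%N.
  move=> H g5 h5 gNh; case: (ltngtP g h) gNh => // gh _.
    by apply: H; rewrite // ltn_eqF.
  have [|l E] := H h g s r gh h5 g5; first by rewrite ltn_eqF.
  by exists l => m; rewrite andbC E.
move=> _ h5 _; set D := col_u g * col_v h - col_v g * col_u h.
have UD : D \is a GRing.unit by exact: det_unit.
exists ((col_v h * r - col_v g * s) / D, (col_u g * s - col_u h * r) / D).
move=> [u v]; apply/andP/eqP => [[/eqP<- /eqP<-]|[-> ->]]; rewrite /form /=.
  congr (_, _); apply: (mulIr UD); rewrite divrK // /D; ring.
split; apply/eqP; apply: (mulIr UD); rewrite mulrDl !mulrA !divrK //.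
  all: rewrite /D; ring.
Qed.

Variable T : {set R}.

Definition valid (p : nat * R) : bool := (p.1 < 5)%N && ((p.1 == 4) ==> (p.2 \in T)).

Definition point := option ((nat * R) * nat).

Definition is_point (x : point) : bool :=
  if x is Some (p, i) then valid p && (i < 3)%N else true.

Definition in_group (g : nat) (x : point) : bool :=
  if x is Some (p, i) then p.1 == g else true.

Definition group_rel g : rel point := fun x y =>
  [&& is_point x, is_point y, in_group g x, in_group g y & x != y].

Definition line_rel (l : R * R) : rel point := fun x y =>
  if x is Some (p, i) then if y is Some (q, j) then
    [&& is_point x, is_point y, p.1 != q.1, form p.1 l == p.2 & form q.1 l == q.2]
  else false else false.

Definition group_points g : seq point :=
  None :: [seq Some ((g, r), i) | r <- [seq r <- enum R | valid (g, r)], i <- iota 0 3].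

Lemma group_points_uniq g : uniq (group_points g).
Proof.
rewrite /group_points cons_uniq; apply/andP; split.
  by apply/negP => /allpairsP[[r i] [_ _]].
apply: allpairs_uniq; first exact/filter_uniq/enum_uniq.
  exact: iota_uniq.
by move=> [r i] [s j] _ _ [-> ->].
Qed.

Lemma group_relE g : (g < 5)%N -> complete (group_points g) =2 group_rel g.
Proof.
move=> g5 x y; have mem z : (z \in group_points g) = is_point z && in_group g z.
  rewrite inE; case: z => [[[h r] i]|//].
  rewrite (_ : (Some _ == None) = false) // orFb [RHS]/=; apply/allpairsP/idP.
    case=> -[s j]; rewrite mem_filter mem_iota => -[/andP[vs _] j3] [-> -> ->].
    by rewrite vs eqxx j3.
  case/andP=> /andP[vr i3] /eqP E; exists (r, i).
  by rewrite mem_filter mem_iota mem_enum -E vr i3.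
by rewrite /complete !mem /group_rel; case: (is_point x); case: (is_point y);
  rewrite ?andbF //= andbF.
Qed.

Lemma size_group_points g : size (group_points g) =
  (3 * (if g == 4 then #|T| else if (g < 5)%N then #|R| else 0)).+1%N.
Proof.
transitivity (size [seq r <- enum R | valid (g, r)] * 3).+1%N.
  by congr S; exact: size_allpairs.
rewrite mulnC; congr (3 * _).+1%N.
rewrite size_filter /valid /=; case: (ltnP g 5) => g5 /=; last first.
  by rewrite gtn_eqF // ?(leq_trans _ g5) // count_pred0.
case: (g == 4) => /=; last by rewrite count_predT -cardE.
by rewrite -size_filter [in RHS]cardE; congr size; rewrite {2}/enum_mem -enumT.
Qed.

Lemma packing_group g k : (g < 5)%N ->
  design_on (if g == 4 then #|T| else #|R|) k -> packing (group_rel g) k.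
Proof.
move=> g5 P; apply: eq_packing (group_relE g5) _.
apply: packing_complete None _ _ _ _ P.
- exact: iota_uniq.
- exact: group_points_uniq.
- by rewrite size_iota size_group_points g5.
Qed.

Lemma packing_line l :
  packing (line_rel l) (if form 4 l \in T then 10 else 6)%N.
Proof.
pose h := (if form 4 l \in T then 5 else 4)%N.
have Pl : packing (fun x y => [&& x < 3 * h, y < 3 * h & x %/ 3 != y %/ 3])%N
    (if form 4 l \in T then 10 else 6)%N.
  by rewrite /h; case: ifP => _; [exact: packing_cliques5|exact: packing_cliques4].
pose f z : point := Some ((z %/ 3, form (z %/ 3) l), z %% 3)%N.
have vh g : valid (g, form g l) = (g < h)%N.
  rewrite /valid /h /=; case: eqP => [->|] /=; first by case: ifP.
  by case: ifP => //; lia.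
have isf z : is_point (f z) = (z < 3 * h)%N.
  by rewrite /f /= vh ltn_mod andbT ltn_divLR // mulnC.
apply: (@packing_map _ _ f [pred z | z < 3 * h]%N) Pl.
- by move=> x y _ _ [E _ E']; rewrite (divn_eq x 3) (divn_eq y 3) E E'.
- by move=> x y /and3P[xh yh _]; apply/andP.
- move=> x y xh yh; rewrite /line_rel {1 2}/f -/(f x) -/(f y) !isf /= !eqxx !andbT.
  by [].
- move=> [[[g r] i]|] [[[g' r'] i']|] //=.
  case/and5P => /andP[vg i3] /andP[vg' i3'] gg' /eqP Er /eqP Er'.
  rewrite -Er vh in vg; rewrite -Er' vh in vg'.
  exists (g * 3 + i)%N, (g' * 3 + i')%N; rewrite /f !divnMDl // !modnMDl.
  rewrite !(divn_small, modn_small) // !addn0 Er Er'; split=> //=; lia.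
Qed.

Definition same_group : rel point := fun x y =>
  if x is Some (p, i) then if y is Some (q, j) then p.1 == q.1 else true
  else true.

Lemma packing_groups k1 k2 : design_on #|R| k1 -> design_on #|T| k2 ->
  packing (fun x y => [&& is_point x, is_point y, same_group x y & x != y])
    (4 * k1 + k2)%N.
Proof.
move=> P1 P2.
have -> : (4 * k1 + k2 = \sum_(g <- iota 0 5) if g == 4 then k2 else k1)%N.
  by rewrite !big_cons big_nil /=; lia.
apply: (packing_bigU (Q_ := group_rel)).
  move=> g; rewrite mem_iota => /= g5; apply: packing_group => //.
  by case: ifP.
move=> x y; have [/and3P[px py xy]|npt] := boolP [&& is_point x, is_point y & x != y];
    last first.
  rewrite (@eq_count _ _ pred0) ?count_pred0 => [|g]; rewrite ?/group_rel.
    case: and4P => // -[px py _ xy]; by rewrite px py xy in npt.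
  by apply/negbTE; apply: contra npt => /and5P[-> -> _ _ ->].
rewrite px py xy andbT (@eq_count _ _ (fun g => in_group g x && in_group g y));
  last by move=> g; rewrite /group_rel px py xy andbT.
have col h r i : is_point (Some ((h, r), i)) -> count (eq_op h) (iota 0 5) = 1%N.
  case/andP=> /andP[h5 _] _; rewrite (eq_count (a2 := pred1 h)) => [|g].
    by rewrite count_uniq_mem ?iota_uniq // mem_iota [(_ < _)%N]h5.
  by rewrite /= eq_sym.
case: x y px py xy => [[[g r] i]|] [[[h s] j]|] // px py xy.
- rewrite [same_group _ _]/=; have [<-|gh] := eqVneq g h.
    by apply: etrans (col g r i px); apply: eq_count => m /=; rewrite andbb.
  apply: etrans (count_pred0 (iota 0 5)); apply: eq_count => m /=.
  by apply/andP => -[/eqP gm /eqP hm]; rewrite gm hm eqxx in gh.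
- by apply: etrans (col g r i px); apply: eq_count => m /=; rewrite andbT.
- exact: col h s j py.
Qed.

Lemma sum_form4 : (\sum_(l : R * R) (form 4 l \in T) = #|R| * #|T|)%N.
Proof.
rewrite -(pair_bigA _ (fun u v => (form 4 (u, v) \in T) : nat)) exchange_big /=.
rewrite -sum_nat_const; apply: eq_big => // v _.
rewrite (reindex_inj (addIr (- (b * v)))) /= -sum1_card [RHS]big_mkcond /=.
apply: eq_bigr => u _; rewrite /form /col_u /col_v /= mul1r subrK.
by case: (u \in T).
Qed.

Lemma packing_lines :
  packing (fun x y => [&& is_point x, is_point y & ~~ same_group x y])
    (6 * #|R| ^ 2 + 4 * (#|R| * #|T|))%N.
Proof.
have -> : (6 * #|R| ^ 2 + 4 * (#|R| * #|T|) =
    \sum_(l <- index_enum (R * R)%type) if form 4 l \in T then 10 else 6)%N.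
  rewrite -sum_form4 big_distrr /= expnS expn1 -card_prod.
  rewrite mulnC -sum_nat_const -big_split; apply: eq_big => // l _ /=.
  by case: ifP.
apply: (packing_bigU (Q_ := line_rel)
  (k_ := fun l => if form 4 l \in T then 10 else 6)%N) => [l _|x y].
  exact: packing_line.
case: x y => [[[g r] i]|] [[[h s] j]|]; rewrite /same_group ?andbF;
  try by rewrite count_pred0.
rewrite /line_rel.
case: (boolP (is_point (Some ((g, r), i)))) => [/andP[/andP[g5 _] _]|_];
  last by rewrite (@eq_count _ _ pred0) ?count_pred0.
case: (boolP (is_point (Some ((h, s), j)))) => [/andP[/andP[h5 _] _]|_];
  last by rewrite (@eq_count _ _ pred0) ?count_pred0.
case: (boolP (g == h)) => [_|gh] /=;
  first by rewrite (@eq_count _ _ pred0) ?count_pred0.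
have [l0 E] := two_columns r s g5 h5 gh.
by rewrite (eq_count E) (count_uniq_mem _ (index_enum_uniq _)) mem_index_enum.
Qed.

Lemma packing_points k1 k2 : design_on #|R| k1 -> design_on #|T| k2 ->
  packing (fun x y => [&& is_point x, is_point y & x != y])
    (4 * k1 + k2 + (6 * #|R| ^ 2 + 4 * (#|R| * #|T|)))%N.
Proof.
move=> P1 P2; have := packingU _ (packing_groups P1 P2) packing_lines.
move=> P; apply: eq_packing (P _) => x y /=; last first.
  by case/and4P => _ _ -> _; rewrite !andbF.
case: (is_point x) => //; case: (is_point y) => //=.
case: x y => [[[g r] i]|] [[[h s] j]|] //=; rewrite ?orbF //.
case: (eqVneq g h) => [->|gh] //=; first by rewrite orbF.
by apply/esym/eqP => -[E]; rewrite E eqxx in gh.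
Qed.

Lemma design_on_transversal k1 k2 : design_on #|R| k1 -> design_on #|T| k2 ->
  design_on (4 * #|R| + #|T|) (4 * k1 + k2 + (6 * #|R| ^ 2 + 4 * (#|R| * #|T|)))%N.
Proof.
move=> P1 P2; rewrite /design_on.
pose ps := [seq (g, r) | g <- iota 0 4, r <- enum R] ++ [seq (4%N, r) | r <- enum T].
pose w : seq point := None :: [seq Some (p, i) | p <- ps, i <- iota 0 3].
have memps p : (p \in ps) = valid p.
  case: p => g r; rewrite mem_cat /valid [(g, r).1]/= [(g, r).2]/=; apply/orP/andP.
    case=> [/allpairsP[[h s] []]|/mapP[s sT [-> ->]]]; last by rewrite -mem_enum sT.
    by rewrite mem_iota => /= h4 _ [-> _]; split; [lia | apply/implyP => /eqP; lia].
  case=> g5 /implyP gT; have [g4|g4] := eqVneq g 4%N.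
    by right; rewrite g4 map_f // mem_enum gT ?g4.
  by left; apply/allpairsP; exists (g, r); rewrite mem_iota mem_enum; split => //=; lia.
have ups : uniq ps.
  rewrite cat_uniq allpairs_uniq ?iota_uniq ?enum_uniq //; last by move=> [? ?] [? ?] _ _ [-> ->].
  rewrite andTb.
  rewrite map_inj_uniq ?enum_uniq ?andbT => [|r s [//]].
  apply/hasPn => _ /mapP[r _ ->]; apply/negP => /allpairsP[[h s] []].
  by rewrite mem_iota => /= h4 _ [E]; rewrite -E in h4.
have mem x : (x \in w) = is_point x.
  rewrite inE; case: x => [[p i]|//].
  rewrite (_ : (Some _ == None) = false) // orFb; apply/allpairsP/idP.
    case=> -[q j] []; rewrite memps mem_iota.
    by move=> vq j3 [-> ->]; rewrite /= vq.
  by case/andP=> vp i3; exists (p, i); rewrite memps mem_iota vp.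
have Pw : packing (complete w) (4 * k1 + k2 + (6 * #|R| ^ 2 + 4 * (#|R| * #|T|)))%N.
  by apply: eq_packing (packing_points P1 P2) => x y; rewrite /complete !mem.
apply: (packing_complete 0%N) Pw.
- rewrite cons_uniq; apply/andP; split; first by apply/negP => /allpairsP[[p i] []].
  by apply: allpairs_uniq => //; move=> [p i] [q j] _ _ [-> ->].
- exact: iota_uniq.
- transitivity (size ps * 3).+1; first by congr S; exact: size_allpairs.
  rewrite size_iota size_cat size_map (size_allpairs _ (iota 0 4)) size_iota.
  by rewrite -!cardE mulnC.
Qed.

End TransversalDesign.

Definition has_units (m : nat) : Prop :=
  exists (R : finComUnitRingType) (a b : R),
    [/\ #|R| = m, a \is a GRing.unit & b \is a GRing.unit] /\
    [/\ (a - 1)%R \is a GRing.unit, (b - 1)%R \is a GRing.unit &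
        (b - a)%R \is a GRing.unit].

Lemma good_transversal m t : has_units m -> t <= m -> good m -> good t ->
  good (4 * m + t).
Proof.
case=> R [a [b [[cR Ua Ub] [Ua1 Ub1 Uba]]]] tm [k1 D1 K1] [k2 D2 K2].
pose T := [set x in take t (enum R)].
have cT : #|T| = t.
  rewrite cardsE (card_uniqP _) ?take_uniq ?enum_uniq // size_take -cardE cR.
  by case: ltnP => // mt; apply/eqP; rewrite eqn_leq tm mt.
rewrite -cR -cT in D1 D2.
have := design_on_transversal Ua Ub Ua1 Ub1 Uba D1 D2; rewrite cR cT => Dn.
by eexists; first exact: Dn; nia.
Qed.

Lemma has_units_coprime6 m : 1 < m -> coprime m 6 -> has_units m.
Proof.
move=> m1; rewrite (coprimeMr m 2 3) => /andP[m2 m3].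
exists 'Z_m, 2%:R%R, 3%:R%R.
have U2 : (2%:R : 'Z_m)%R \is a GRing.unit by rewrite unitZpE.
have U3 : (3%:R : 'Z_m)%R \is a GRing.unit by rewrite unitZpE.
have -> : (2%:R - 1 = 1 :> 'Z_m)%R by ring.
have -> : (3%:R - 1 = 2%:R :> 'Z_m)%R by ring.
have -> : (3%:R - 2%:R = 1 :> 'Z_m)%R by ring.
by rewrite card_ord Zp_cast // U2 U3 unitr1.
Qed.

Lemma two_others (T : finType) (x y : T) : x != y -> 3 < #|T| ->
  exists a b, [/\ a != x, a != y, b != x, b != y & a != b].
Proof.
move=> xy cT; have /card_gt1P[a [b []]] : 1 < #|[set~ x] :\ y|.
  by have := cardsD1 y [set~ x]; rewrite cardsC1 !inE eq_sym xy; lia.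
by rewrite !inE => /andP[ay ax] /andP[bY bx] ab; exists a, b.
Qed.

Lemma has_units_prime_power p k : prime p -> 3 < p ^ k -> has_units (p ^ k).
Proof.
move=> pp pk; have k0 : 0 < k by case: k pk.
have [F _ cF] := pPrimePowerField pp k0.
have [a [b [a0 a1 b0 b1 ab]]] : exists a b : F,
    [/\ a != 0%R, a != 1%R, b != 0%R, b != 1%R & a != b].
  by apply: two_others; rewrite ?cF // eq_sym oner_neq0.
exists F, a, b; rewrite cF !unitfE !subr_eq0 a0 b0 a1 b1.
by rewrite eq_sym ab.
Qed.

(* The gaps left by 4m <= n <= 5m, for the available m, are the base designs. *)
Lemma all_good n : good n.
Proof.
elim/ltn_ind: n => n IHn.
case: (boolP (n \in 0 :: map fst base_designs)) => [|nB].
  by rewrite inE => /predU1P[->|]; [exact: good0|exact: good_base].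
suff [m [um mn nm]] : exists m, [/\ has_units m, 4 * m <= n & n <= 5 * m].
  have m0 : 0 < m by case: um => R [a [b [[<- _ _] _]]]; apply/card_gt0P; exists a.
  have -> : n = 4 * m + (n - 4 * m) by lia.
  by apply: good_transversal => //; [lia | apply: IHn; lia | apply: IHn; lia].
have c6 m : 1 < m -> (m %% 6 == 1) || (m %% 6 == 5) -> has_units m.
  move=> m1 E; apply: has_units_coprime6 => //.
  by rewrite -coprime_modl; case/orP: E => /eqP->.
have f4 : has_units 4 by exact: (@has_units_prime_power 2 2).
have f9 : has_units 9 by exact: (@has_units_prime_power 3 2).
have f16 : has_units 16 by exact: (@has_units_prime_power 2 4).
have [n15 n26 n27] : [/\ 16 <= n, n != 26 & n != 27].
  move: nB; rewrite inE (_ : map fst base_designs = iota 1 15 ++ [:: 26; 27]) //.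
  by rewrite mem_cat mem_iota !inE => H; split; lia.
have [n72|n72] := leqP 72 n.
  pose q := n %/ 4; pose m := q - nth 0 [:: 1; 0; 1; 2; 3; 0] (q %% 6).
  have q18 : 18 <= q by rewrite /q; lia.
  have [mq m6] : q <= m + 3 /\ (m %% 6 == 1) || (m %% 6 == 5).
    by rewrite /m; case E: (q %% 6) => [|[|[|[|[|[|k]]]]]] /=; lia.
  by exists m; split; [apply: c6 => //; lia | rewrite /m /q; lia | lia].
have [?|?] := leqP n 20; first by exists 4; split => //; lia.
have [?|?] := leqP n 25; first by exists 5; split; [exact: c6|lia|lia].
have [?|?] := leqP n 35; first by exists 7; split; [exact: c6|lia|lia].
have [?|?] := leqP n 45; first by exists 9; split => //; lia.
have [?|?] := leqP n 55; first by exists 11; split; [exact: c6|lia|lia].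
have [?|?] := leqP n 65; first by exists 13; split; [exact: c6|lia|lia].
by exists 16; split => //; lia.
Qed.

Lemma design_of_packing (V : finType) (k : nat) :
  packing (fun x y : V => x != y) k ->
  exists B : {set 4.-tuple V}, [/\ directed_design B,
    #|V| * #|V|.-1 <= 6 * #|B| & #|B| <= min_defining_size B + k].
Proof.
case=> L [sL L4 pL uL QL].
have [L' EL] : exists L' : seq (seq (4.-tuple V)), map (map val) L' = L.
  exists (map (pmap insub) L); rewrite -map_comp -[RHS]map_id.
  apply/eq_in_map => c cL /=; rewrite (pmap_filter (insubK _)).
  apply/all_filterP/allP => b bc; rewrite isSome_insub.
  by apply/eqP/L4/flattenP; exists c.
have Ds : design_list (flatten L').
  by rewrite /design_list /blocks map_flatten EL.
have uD := design_list_uniq Ds.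
have cB : #|[set b in flatten L']| = size (flatten L').
  by rewrite cardsE; apply/card_uniqP.
exists [set b in flatten L']; split; first exact: design_listP.
- have := size_covered L4; rewrite -{2}EL -map_flatten size_map -cB => <-.
  have : #|{: V * V}| <= size (covered (flatten L)) + #|V|.
    rewrite cardE [#|V|]cardE -(size_map (fun x => (x, x)) (enum V)) -size_cat.
    apply: uniq_leq_size => [|[x y] _]; first exact: enum_uniq.
    rewrite mem_cat QL; case: eqVneq => //= <-.
    by apply/mapP; exists x; rewrite ?mem_enum.
  by rewrite card_prod; case: #|V| => // m; lia.
- rewrite /min_defining_size; case: arg_minnP => [|S dS _].
    exact/defining_set_refl/design_listP.
  rewrite cB; apply: leq_trans (defining_set_ge Ds _ dS) _.
    rewrite -EL all_map in pL; apply: sub_all pL => c.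
    by rewrite /= pairwise_map.
  by rewrite leq_add2l -(size_map (map val)) EL.
Qed.

Lemma large_defining_sets v : 1312 < v -> v = 1 %[mod 3] ->
  exists2 B : {set 4.-tuple 'I_v}, directed_design B &
    0 < #|B| /\ 5 * #|B| <= 8 * min_defining_size B.
Proof.
move=> v0 v1.
have [n En] : exists n, v = (3 * n).+1.
  exists (v %/ 3); rewrite {1}(divn_eq v 3) v1 mulnC; lia.
rewrite {v1}En in v0 *.
have [k Dk hk] := all_good n.
have Pk : packing (fun x y : 'I_(3 * n).+1 => x != y) k.
  apply: (@eq_packing _ (complete (enum 'I_(3 * n).+1))) => [x y|].
    by rewrite /complete !mem_enum.
  by apply: (packing_complete ord0) Dk; rewrite ?iota_uniq ?enum_uniq ?size_iota ?size_enum_ord.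
have [B [dB lB hB]] := design_of_packing Pk; exists B => //.
rewrite card_ord /= in lB.
have : 1312 * n <= (3 * n).+1 * n by rewrite leq_mul2r (ltnW v0) orbT.
by move: lB hB hk v0; move: #|B| (min_defining_size B) => b N; split; nia.
Qed.

Local Open Scope ring_scope.

Theorem theorem3p5 (R : realType) (eps : R) (heps : 0 < eps) :
  exists v0 : nat, forall v : nat, (v0 < v)%N -> v = 1 %[mod 3] ->
    exists2 B : {set 4.-tuple 'I_v}, directed_design B &
      5%:R / 8%:R - (13%:R / 8%:R + eps) / v%:R <= defining_ratio R B.
Proof.
exists 1312%N => v v0 /(large_defining_sets v0)[B dB [B0 B58]].
exists B => //.
apply: (@le_trans _ _ (5%:R / 8%:R)).
  rewrite gerBl divr_ge0 ?ler0n // addr_ge0 ?divr_ge0 ?ler0n //; exact: ltW.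
rewrite /defining_ratio ler_pdivlMr ?ltr0n // mulrAC ler_pdivrMr ?ltr0n //.
by rewrite -!natrM ler_nat [leqRHS]mulnC.
Qed.
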